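(* Let $0<q<1$, and let $\{\omega_n(z;q)\}_{n}$ and $\{\hat\omega_n(z;q)\}_{n}$ be conjugate even $q$-Lidstone-type I sequences, where $\{\omega_n(z;q)\}_n$ is related to the numerical sequence $(\gamma_{2n})_{n\ge0}$. Then $$h_q(t)\cosh_q(zt)=\sum_{n=0}^\infty\omega_n(z;q)\frac{t^{2n}}{[2n]_q!},\qquad \frac1{h_q(t)}\cosh_q(zt)=\sum_{n=0}^\infty\hat\omega_n(z;q)\frac{t^{2n}}{[2n]_q!},$$ where $h_q(t)$ is the function defined by the power series $h_q(t)=\sum_{n=0}^\infty\gamma_{2n}\frac{t^{2n}}{[2n]_q!}$.
   Context: Fix $0<q<1$. Put $[m]_q=\frac{1-q^m}{1-q}$, $[m]_q!=\prod_{j=1}^m[j]_q$, $[0]_q!=1$, and ${n \brack k}_q=\frac{[n]_q!}{[k]_q!\,[n-k]_q!}$ for $0\le k\le n$. $\mathbb N=\{1,2,\dots\}$, $\mathbb N_0=\mathbb N\cup\{0\}$. The Jackson $q$-derivative is $D_qf(z)=\frac{f(qz)-f(z)}{(q-1)z}$ for $z\ne0$ and $D_qf(0)=f'(0)$, so $D_qz^m=[m]_qz^{m-1}$. An even $q$-Lidstone polynomial sequence of type I is a sequence $\{\omega_n(z;q)\}_{n\in\mathbb N_0}$ of polynomials in $z$ with real coefficients such that $D_q^2\omega_n(z;q)=[2n]_q[2n-1]_q\,\omega_{n-1}(z;q)$ for $n\in\mathbb N$, $D_q\omega_n(0;q)=0$ for $n\in\mathbb N_0$, and $\omega_0(z;q)=\gamma_0$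 with $\gamma_0\in\mathbb R\setminus\{0\}$. The numerical sequence related to it is $\gamma_{2n}:=\omega_n(0;q)$, and $\omega_n(z;q)=\sum_{k=0}^n{2n \brack 2k}_q\gamma_{2(n-k)}z^{2k}$. The sequence $(\xi_{2n})_{n\ge0}$ is the numerical sequence satisfying $\sum_{j=0}^n\frac{\gamma_{2j}\,\xi_{2(n-j)}}{[2j]_q!\,[2(n-j)]_q!}=\delta_{n0}$ for all $n\in\mathbb N_0$ ($\delta$ is Kronecker's delta). With $\hat\omega_n(z;q)=\sum_{k=0}^n{2n \brack 2k}_q\xi_{2(n-k)}z^{2k}$, the two sequences $\{\omega_n\}_n$ and $\{\hat\omega_n\}_n$ are called conjugate even $q$-Lidstone-type I sequences. $\cosh_q(x)=\sum_{n=0}^\infty\frac{x^{2n}}{[2n]_q!}$. Since $\gamma_0\neq0$, $1/h_q(t)$ is well defined, with series representation $\frac1{h_q(t)}=\sum_{n=0}^\infty\xi_{2n}\frac{t^{2n}}{[2n]_q!}$. *)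

(* Defs.v *)
From HB Require Import structures.
From mathcomp Require Import all_boot all_order all_algebra.
From mathcomp Require Import complex.
From mathcomp Require Import all_classical all_reals all_analysis.

Set Implicit Arguments.
Unset Strict Implicit.
Unset Printing Implicit Defensive.

Import Order.TTheory GRing.Theory Num.Theory.
Import numFieldNormedType.Exports.

Local Open Scope classical_set_scope.
Local Open Scope ring_scope.

(* The complex numbers. R[i] itself carries no topology in the libraries;
   seeing it as a numFieldType gives it the topology of its modulus. *)
Definition Cx (R : realType) : numFieldType := R[i].

Definition toC (R : realType) (x : R) : Cx R := real_complex R x.

Definition qnum (F : fieldType) (q : F) (m : nat) : F :=
  (1 - q ^+ m) / (1 - q).

Definition qfact (F : fieldType) (q : F) (m : nat) : F :=
  \prod_(1 <= j < m.+1) qnum q j.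

(* Meaningful for k <= n only. *)
Definition qbinom (F : fieldType) (q : F) (n k : nat) : F :=
  qfact q n / (qfact q k * qfact q (n - k)).

Definition Dq (K : numFieldType) (q : K) (f : K -> K) (z : K) : K :=
  if z == 0 then derive1 f 0 else (f (q * z) - f z) / ((q - 1) * z).

Definition poly_fun (R : realType) (p : {poly R}) (z : Cx R) : Cx R :=
  (map_poly (@toC R) p).[z].

Definition even_qLidstone_I (R : realType) (q : R) (w : nat -> {poly R}) :
    Prop :=
  [/\ forall n : nat, (0 < n)%N -> forall z : Cx R,
        Dq (toC q) (Dq (toC q) (poly_fun (w n))) z =
        toC (qnum q n.*2 * qnum q n.*2.-1) * poly_fun (w n.-1) z,
      forall n : nat, Dq (toC q) (poly_fun (w n)) 0 = 0 &
      exists2 gamma0 : R, gamma0 != 0 & w 0%N = gamma0%:P].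

(* Numerical sequences indexed by even numbers are reindexed by n: gamma n
   and xi n stand for gamma_{2n} and xi_{2n}. *)
Definition related_seq (R : realType) (w : nat -> {poly R}) (n : nat) : R :=
  (w n).[0].

Definition conjugate_num_seq (R : realType) (q : R) (gamma xi : nat -> R) :
    Prop :=
  forall n : nat,
    \sum_(j < n.+1) gamma j * xi (n - j)%N /
        (qfact q j.*2 * qfact q (n - j).*2) = (n == 0%N)%:R.

Definition qLidstone_poly (R : realType) (q : R) (c : nat -> R) (n : nat) :
    {poly R} :=
  \sum_(k < n.+1) (qbinom q n.*2 k.*2 * c (n - k)%N) *: 'X^(k.*2).

(* Terms and, when convergent, sum of the series sum_n a_n t^(2n) / [2n]_q!. *)
Definition qexp_even_term (K : numFieldType) (q : K) (a : nat -> K) (t : K)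
    (n : nat) : K :=
  a n * t ^+ n.*2 / qfact q n.*2.

Definition qexp_even_sum (K : numFieldType) (q : K) (a : nat -> K) (t : K) :
    K :=
  lim (series (qexp_even_term q a t) @ \oo).

Definition coshq (K : numFieldType) (q x : K) : K :=
  qexp_even_sum q (fun=> 1) x.

Definition hq (R : realType) (q : R) (gamma : nat -> R) (t : Cx R) : Cx R :=
  qexp_even_sum (toC q) (fun n => toC (gamma n)) t.

(* A formal power series in t over {poly R} (polynomials in z) is represented
   by its sequence of coefficients. *)
Definition fps_mul (A : nzRingType) (a b : nat -> A) (n : nat) : A :=
  \sum_(i < n.+1) a i * b (n - i)%N.

Definition fps_one (A : nzRingType) (n : nat) : A := (n == 0%N)%:R.

(* The formal series sum_n a_n t^(2n) / [2n]_q!. *)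
Definition fps_qexp_even (R : realType) (q : R) (a : nat -> {poly R})
    (m : nat) : {poly R} :=
  if odd m then 0 else (qfact q m)^-1 *: a m./2.

Definition fps_hq (R : realType) (q : R) (gamma : nat -> R) :
    nat -> {poly R} :=
  fps_qexp_even q (fun n => (gamma n)%:P).

(* cosh_q(zt): the coefficient of t^(2n) / [2n]_q! is z^(2n). *)
Definition fps_coshq (R : realType) (q : R) : nat -> {poly R} :=
  fps_qexp_even q (fun n => 'X^(n.*2)).

(* Main.v *)
(* The recursion D_q^2 w_n = [2n][2n-1] w_(n-1) together with the values at 0
   determines the coefficients of w_n one by one, so that w_n is the q-Lidstone
   polynomial of gamma. Both expansions are then Cauchy products. Since cosh_q
   converges absolutely for |x| < 1/(1-q), Mertens' theorem applies as soon as
   the other factor converges. The series of gamma and xi may both converge only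
   conditionally, but their Cauchy product is the constant series 1, and a
   convergent Cauchy product of convergent series has the expected sum: the mean
   of A_i B_(n-i) tends to A B. *)
Require Import Defs.
From HB Require Import structures.
From mathcomp Require Import all_boot all_order all_algebra.
From mathcomp Require Import complex.
From mathcomp Require Import all_classical all_reals all_analysis ring lra.

Set Implicit Arguments.
Unset Strict Implicit.
Unset Printing Implicit Defensive.

Import Order.TTheory GRing.Theory Num.Theory.
Import numFieldNormedType.Exports.
Import Normc.

Local Open Scope classical_set_scope.
Local Open Scope ring_scope.

(** * Complex sequences and series *)

(* The norm of Cx R takes complex values; estimates are made on the real-valued
   modulus normc instead. *)
Lemma normCxE (R : realType) (z : Cx R) : `|z| = toC (normc z).
Proof. by case: z. Qed.

Lemma toC_lt (R : realType) (x y : R) : (toC x < toC y) = (x < y).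
Proof. exact: ltcR. Qed.

Lemma toC_le (R : realType) (x y : R) : (toC x <= toC y) = (x <= y).
Proof. exact: lecR. Qed.

(** The order on [Cx R] forces a positive number to have zero imaginary part, so every epsilon of a
    complex limit is a real one. *)
Lemma toC_gt0 (R : realType) (e : Cx R) :
  0 < e -> exists2 d : R, 0 < d & e = toC d.
Proof. case: e => a b; rewrite ltcE/= => /andP[/eqP-> h]; by exists a. Qed.

Lemma normc_ge0 (R : realType) (z : Cx R) : 0 <= normc z.
Proof. by case: z => a b; exact: sqrtr_ge0. Qed.

Lemma cvgn0_normc (R : realType) (u : nat -> Cx R) :
  u @ \oo --> (0 : Cx R) <-> (fun n => normc (u n)) @ \oo --> (0 : R).
Proof.
split=> /cvgr0Pnorm_lt h; apply/cvgr0Pnorm_lt => e e0.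
- have := h (toC e); rewrite toC_lt => /(_ e0).
  apply: filterS => n; rewrite normCxE toC_lt.
  by rewrite ger0_norm ?normc_ge0.
- have [d d0 ->] := toC_gt0 e0; have := h _ d0.
  apply: filterS => n; rewrite normCxE toC_lt.
  by apply: le_lt_trans; exact: ler_norm.
Qed.

Lemma normc_triangle (R : realType) (y z : Cx R) :
  normc (y + z) <= normc y + normc z.
Proof. exact: le_normcD. Qed.

Lemma normc_sum (R : realType) (I : Type) (r : seq I) (P : pred I)
    (u : I -> Cx R) :
  normc (\sum_(i <- r | P i) u i) <= \sum_(i <- r | P i) normc (u i).
Proof.
elim/big_ind2 : _ => [|x a y b h1 h2|//]; first by rewrite normc0.
by rewrite (le_trans (normc_triangle _ _))// lerD.
Qed.

Lemma normcX (R : realType) (z : Cx R) n : normc (z ^+ n) = normc z ^+ n.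
Proof. by elim: n => [|n ih]; rewrite ?normc1// !exprS normcM ih. Qed.

Lemma normc_toC (R : realType) (x : R) : normc (toC x) = `|x|.
Proof. by rewrite /normc/= expr0n addr0 sqrtr_sqr. Qed.

Lemma Re_le_normc (R : realType) (z : Cx R) : `|complex.Re z| <= normc z.
Proof. by rewrite -toC_le -normCxE; exact: normc_ge_Re. Qed.

Lemma Im_le_normc (R : realType) (z : Cx R) : `|complex.Im z| <= normc z.
Proof. by case: z => a b /=; rewrite -sqrtr_sqr ler_wsqrtr// lerDr sqr_ge0. Qed.

Lemma normc_le_ReIm (R : realType) (z : Cx R) :
  normc z <= `|complex.Re z| + `|complex.Im z|.
Proof.
case: z => a b /=; rewrite -[leRHS]ger0_norm ?addr_ge0// -sqrtr_sqr ler_wsqrtr//.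
by rewrite sqrrD !real_normK ?num_real// -addrAC lerDl mulrn_wge0// mulr_ge0.
Qed.

Lemma ReB (R : realType) (y z : Cx R) :
  complex.Re (y - z) = complex.Re y - complex.Re z.
Proof. by case: y z => [a b] []. Qed.

Lemma ImB (R : realType) (y z : Cx R) :
  complex.Im (y - z) = complex.Im y - complex.Im z.
Proof. by case: y z => [a b] []. Qed.

Lemma Re_series (R : realType) (u : nat -> Cx R) n :
  complex.Re (series u n) = series (@complex.Re R \o u) n.
Proof.
elim: n => [|n ih]; first by rewrite /series/= !big_geq.
by rewrite !seriesSr -ih /=; case: (series u n) (u n) => [a b] [].
Qed.

Lemma Im_series (R : realType) (u : nat -> Cx R) n :
  complex.Im (series u n) = series (@complex.Im R \o u) n.
Proof.
elim: n => [|n ih]; first by rewrite /series/= !big_geq.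
by rewrite !seriesSr -ih /=; case: (series u n) (u n) => [a b] [].
Qed.

(** Real and imaginary parts are dominated by the modulus, so both real series converge absolutely;
    completeness is only used in [R]. *)
Lemma normc_cvg_series (R : realType) (u : nat -> Cx R) :
  cvgn (series (fun n => normc (u n))) -> cvgn (series u).
Proof.
move=> cu.
have cvp (p : Cx R -> R) :
    (forall z, `|p z| <= normc z) -> cvgn (series (p \o u)).
  move=> pn; apply: normed_cvg.
  apply: (@series_le_cvg _ _ (fun n => normc (u n))) => [n|n|n|] /=.
  - exact: normr_ge0.
  - exact: normc_ge0.
  - exact: pn.
  - exact: cu.
have /cvgrPdist_lt cr := cvp _ (@Re_le_normc R).
have /cvgrPdist_lt ci := cvp _ (@Im_le_normc R).
set a := limn _ in cr; set b := limn _ in ci.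
apply/cvg_ex; exists (Complex a b : Cx R).
apply/cvgrPdist_lt => e e0; have [d d0 ->] := toC_gt0 e0.
have d20 : 0 < d / 2 by rewrite divr_gt0.
near=> n; rewrite normCxE toC_lt (le_lt_trans (normc_le_ReIm _))//.
rewrite (splitr d) ltrD//.
- by rewrite ReB Re_series; near: n; exact: cr.
- by rewrite ImB Im_series; near: n; exact: ci.
Unshelve. all: by end_near. Qed.

(** * Nonnegative real series: ratio test and null convolutions *)

Lemma cvg_series_ratio (R : realType) (y : R ^nat) (s : R) N :
  0 < s < 1 -> (forall n, 0 <= y n) ->
  (forall n, (N <= n)%N -> y n.+1 <= s * y n) -> cvgn (series y).
Proof.
(* [C] majorizes each [y i / s ^+ i] with [i <= N], so [y n <= C * s ^+ n] holds up to [N] and the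
   ratio hypothesis carries it further. *)
move=> /andP[s0 s1] y0 ys; pose C := \sum_(i < N.+1) y i / s ^+ i.
have C0 : 0 <= C by apply: sumr_ge0 => i _; rewrite divr_ge0// exprn_ge0// ltW.
have yC n : y n <= C * s ^+ n.
  elim: n => [|n ih].
    rewrite expr0 mulr1 /C big_ord_recl expr0 divr1 lerDl.
    by apply: sumr_ge0 => i _; rewrite divr_ge0// exprn_ge0// ltW.
  case: (leqP N n) => [/ys /le_trans->//|nN].
    by rewrite exprS mulrCA ler_pM2l.
  rewrite -ler_pdivrMr ?exprn_gt0// /C.
  rewrite (bigD1 (Ordinal (nN : (n.+1 < N.+1)%N)))//= lerDl.
  by apply: sumr_ge0 => i _; rewrite divr_ge0// exprn_ge0// ltW.
apply: (@series_le_cvg _ _ (geometric C s)) => //.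
- by move=> n; rewrite /= mulr_ge0// exprn_ge0// ltW.
- by apply: is_cvg_geometric_series; rewrite ger0_norm// ltW.
Qed.

(** The sum of [y i * x (n - i)] is split at a fixed index [N2]: before it [n - i] is large and [x]
    is small; after it [x] is bounded and the tail of [y] is small. *)
Lemma convolution_cvg0 (R : realType) (x y : R ^nat) :
  (forall n, 0 <= x n) -> (forall n, 0 <= y n) ->
  x @ \oo --> 0 -> cvgn (series y) -> fps_mul y x @ \oo --> 0.
Proof.
move=> x0 y0 xcvg ycvg.
have [M M0 xM] : exists2 M, 0 < M & forall n, x n <= M.
  have /cvg_seq_bounded[M [_ hM]] : cvgn x by apply/cvg_ex; exists 0.
  exists (`|M| + 1) => [|n]; first by rewrite ltr_wpDl.
  by rewrite -[x n]ger0_norm// hM ?ltr_pwDr// ?ler_norm.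
pose S := limn (series y).
have yS n : series y n <= S.
  by apply: nondecreasing_cvgn_le => //; exact: nondecreasing_series.
have S0 : 0 <= S by apply: le_trans (yS 0%N); rewrite seriesEnat/= big_geq.
apply/cvgr0Pnorm_le => e e0.
(* Each half of the sum may cost [e / 2]; [S + 1] replaces [S], which may be zero. *)
pose e1 := e / 2 / (S + 1); pose e2 := e / 2 / M.
have e10 : 0 < e1 by rewrite !divr_gt0// ltr_wpDl.
have e20 : 0 < e2 by rewrite !divr_gt0.
have [N1 _ hN1] := (cvgr0Pnorm_le _).1 xcvg _ e10.
have [N2 _ hN2] := (cvgrPdist_le _ _).1 ycvg _ e20.
exists (N1 + N2)%N => // n /= nN.
rewrite ger0_norm; last by apply: sumr_ge0 => i _; rewrite mulr_ge0.
apply: (@le_trans _ _ (\sum_(i < n.+1)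
    (e1 * y i + M * (if (N2 <= i)%N then y i else 0)))).
  apply: ler_sum => i _; case: (leqP N2 i) => iN.
    rewrite (mulrC M) (le_trans (ler_wpM2l (y0 i) (xM _)))// lerDr.
    by rewrite mulr_ge0// ltW.
  rewrite mulr0 addr0 mulrC ler_wpM2r//.
  rewrite -[leLHS]ger0_norm//; apply: hN1 => /=.
  rewrite -(leq_add2r i) subnK; last exact: ltn_ord i.
  by apply: leq_trans nN; rewrite leq_add2l ltnW.
rewrite big_split/= -!mulr_sumr -big_mkcond/= (splitr e) lerD//.
- rewrite -[leRHS](@divfK _ (S + 1)) ?gt_eqF ?ltr_wpDl//.
  rewrite ler_wpM2l ?(ltW e10)// (le_trans _ (_ : S <= _)) ?lerDl//.
  by have := yS n.+1; rewrite seriesEord.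
- rewrite -[leRHS](@divfK _ M) ?gt_eqF// mulrC ler_wpM2r ?(ltW M0)//.
  have -> : \sum_(i < n.+1 | (N2 <= i)%N) y i = series y n.+1 - series y N2.
    rewrite sub_series_geq; last first.
      by rewrite (leq_trans _ (leq_trans nN (leqnSn _))) ?leq_addl.
    by rewrite big_geq_mkord.
  have := hN2 _ (leqnn N2); rewrite ger0_norm ?subr_ge0//; apply: le_trans.
  by rewrite lerD2r.
Qed.

(** * Partial sums of Cauchy products *)

Lemma fps_mulC (A : comNzRingType) (a b : nat -> A) : fps_mul a b = fps_mul b a.
Proof.
apply/funext => n; rewrite /fps_mul (reindex_inj rev_ord_inj)/=.
by apply: eq_bigr => i _; rewrite mulrC subSS subKn// -ltnS.
Qed.

(** Taking partial sums is multiplication by the formal series 1/(1-t), which may be absorbed into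
    one factor. *)
Lemma series_fps_mul (K : numFieldType) (a b : nat -> K) (n : nat) :
  series (fps_mul a b) n.+1 = fps_mul (fun k => series a k.+1) b n.
Proof.
rewrite fps_mulC [in RHS]fps_mulC; elim: n => [|n ih].
  by rewrite /fps_mul /series/= !big_nat1 !big_ord1/= big_nat1.
rewrite seriesSr ih [in RHS]/fps_mul.
under [RHS]eq_bigr do rewrite seriesSr mulrDr.
rewrite big_split/=; congr (_ + _); rewrite /fps_mul.
rewrite [RHS]big_ord_recr/= subnn [series a 0]big_geq// mulr0 addr0.
by apply: eq_bigr => i _; rewrite subSn// -ltnS.
Qed.

Lemma cvgn_sub0 (K : numFieldType) (u v : nat -> K) (l : K) :
  v @ \oo --> l -> (fun n => u n - v n) @ \oo --> 0 -> u @ \oo --> l.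
Proof.
move=> vl uv; rewrite -(add0r l).
rewrite (_ : u = (fun n => (u n - v n) + v n)); last first.
  by apply/funext => n; rewrite subrK.
exact: cvgD.
Qed.

(** With A_k the partial sums of [a], the partial sum of the product differs from A times that of
    [b] by the convolution of A_k - A with [b], a null sequence against an absolutely convergent
    series. *)
Lemma mertens (R : realType) (a b : nat -> Cx R) :
  cvgn (series a) -> cvgn (series (fun n => normc (b n))) ->
  series (fps_mul a b) @ \oo --> limn (series a) * limn (series b).
Proof.
move=> ca cnb; have cb := normc_cvg_series cnb; set A := limn (series a).
rewrite -cvg_shiftS/=; apply: (@cvgn_sub0 _ _ (fun n => A * series b n.+1)).
  by apply: cvgMr; rewrite cvg_shiftS.
apply/cvgn0_normc.
have h0 : (fun n => normc (series a n.+1 - A)) @ \oo --> 0.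
  apply/cvgn0_normc; rewrite -(subrr A); apply: cvgB; last exact: cvg_cst.
  rewrite (cvg_shiftS (series a)); exact: ca.
have := convolution_cvg0 (fun=> normc_ge0 _) (fun=> normc_ge0 _) h0 cnb.
apply: squeeze_cvgr; last exact: cvg_cst.
apply: nearW => n; rewrite normc_ge0/=.
rewrite series_fps_mul fps_mulC [series b]seriesEord/= mulr_sumr -sumrB.
apply: le_trans (normc_sum _ _ _) _; apply: ler_sum => i _.
by rewrite (mulrC A) -mulrBr normcM.
Qed.

Lemma cvgn_normc_bounded (R : realType) (u : nat -> Cx R) (l : Cx R) :
  u @ \oo --> l -> exists M, forall n, normc (u n) <= M.
Proof.
move=> ul; have /cvg_seq_bounded[M [Mr hM]] : cvgn u by apply/cvg_ex; exists l.
(* Boundedness is available only for numbers strictly above [M], hence [M + 1]; being a complex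
   number, it is replaced by its real part. *)
exists (complex.Re (M + 1)) => n; have := hM (M + 1); rewrite ltrDl ltr01.
by move=> /(_ isT n I); rewrite /= normCxE lecE/= => /andP[].
Qed.

(* x_i y_j - X Y = (x_i - X) y_j + X (y_j - Y): Cesaro's lemma handles the means
   of both parts. *)
Lemma cesaro_fps_mul (R : realType) (x y : nat -> Cx R) (X Y : Cx R) :
  x @ \oo --> X -> y @ \oo --> Y ->
  (fun n => n.+1%:R^-1 * fps_mul x y n) @ \oo --> X * Y.
Proof.
move=> xX yY.
have d0 (u : nat -> Cx R) l : u @ \oo --> l ->
    arithmetic_mean (fun n => normc (u n - l)) @ \oo --> 0.
  move=> ul; apply: cesaro; apply/cvgn0_normc; rewrite -(subrr l).
  exact: (cvgB ul (cvg_cst l)).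
have [M yM] := cvgn_normc_bounded yY.
apply: (@cvgn_sub0 _ _ (fun=> X * Y)); first exact: cvg_cst.
apply/cvgn0_normc.
have h0 : (fun n => M * arithmetic_mean (fun n => normc (x n - X)) n +
    normc X * arithmetic_mean (fun n => normc (y n - Y)) n) @ \oo --> 0.
  rewrite -[0](addr0 0) -[X in X + _](mulr0 M) -[X in _ + X](mulr0 (normc X)).
  exact: cvgD (cvgM (cvg_cst M) (d0 _ _ xX))
    (cvgM (cvg_cst (normc X)) (d0 _ _ yY)).
apply: squeeze_cvgr (cvg_cst 0) h0.
apply: nearW => n; rewrite normc_ge0/=.
have -> : n.+1%:R^-1 * fps_mul x y n - X * Y =
    n.+1%:R^-1 * (\sum_(i < n.+1) (x i - X) * y (n - i)%N +
                  X * \sum_(i < n.+1) (y i - Y)).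
  rewrite sumrB sumr_const card_ord mulrBr -[Y *+ _]mulr_natr.
  under eq_bigr do rewrite mulrBl.
  rewrite sumrB -mulr_sumr 
    (_ : \sum_(i < n.+1) y (n - i)%N = \sum_(i < n.+1) y i).
    by rewrite addrA subrK mulrBr (mulrA X) (mulrC _ n.+1%:R) mulKf ?pnatr_eq0.
  rewrite (reindex_inj rev_ord_inj)/=.
  by apply: eq_bigr => i _; rewrite subSS subKn// -ltnS.
rewrite normcM /arithmetic_mean/= ![_ * (_^-1 * _)]mulrCA -mulrDr.
have -> : normc (n.+1%:R^-1 : Cx R) = n.+1%:R^-1.
  by rewrite -(rmorph_nat (real_complex R)) -fmorphV -/(toC _) normc_toC ger0_norm.
rewrite ler_wpM2l// (le_trans (normc_triangle _ _))// lerD//.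
- rewrite seriesEord/= mulr_sumr (le_trans (normc_sum _ _ _))//.
  by apply: ler_sum => i _; rewrite normcM mulrC ler_wpM2r ?normc_ge0.
- by rewrite normcM ler_wpM2l ?normc_ge0// seriesEord normc_sum.
Qed.

(* The partial sums of the partial sums of a Cauchy product are the convolution
   of the partial sums of the factors. *)
Lemma cvg_series_fps_mul (R : realType) (a b : nat -> Cx R) (l : Cx R) :
  cvgn (series a) -> cvgn (series b) -> series (fps_mul a b) @ \oo --> l ->
  l = limn (series a) * limn (series b).
Proof.
move=> ca cb cab.
have sh (u : nat -> Cx R) (v : Cx R) :
    u @ \oo --> v -> (fun n => u n.+1) @ \oo --> v.
  by move=> uv; rewrite cvg_shiftS.
have h1 := cesaro_fps_mul (sh (series a) _ ca) (sh (series b) _ cb).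
(* Convolving with the constant 1 turns [h2] into the plain mean of the partial sums of the product,
   with limit [l]. *)
have h2 := cesaro_fps_mul (sh (series (fps_mul a b)) _ cab) (cvg_cst (1 : Cx R)).
rewrite -[l]mulr1; apply: (norm_cvg_unique (h2 _)).
rewrite (_ : (fun n => _) = (fun n => n.+1%:R^-1 *
    fps_mul (fun k => series a k.+1) (fun k => series b k.+1) n)) //.
apply/funext => n; congr (_ * _).
transitivity (\sum_(i < n.+1) series (fps_mul a b) i.+1).
  by apply: eq_bigr => i _; rewrite mulr1.
(* [series_fps_mul] is used twice: once to extract the summation from [a], once to extract it from
   [b]. *)
rewrite -(series_fps_mul a) [in RHS]seriesEord; apply: eq_bigr => i _.
by rewrite (fps_mulC a b) series_fps_mul (fps_mulC a).
Qed.

Lemma series_fps_one (K : numFieldType) n : series (@fps_one K) n.+1 = 1.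
Proof. by rewrite /series/= big_nat_recl// big1 ?addr0. Qed.

(** * The polynomials w_n *)

Lemma qnum_gt0 (F : realFieldType) (q : F) m : 0 < q < 1 -> 0 < qnum q m.+1.
Proof.
by move=> /andP[q0 q1]; rewrite divr_gt0 ?subr_gt0// exprn_ilt1// ltW.
Qed.

Lemma qfactS (F : fieldType) (q : F) m : qfact q m.+1 = qfact q m * qnum q m.+1.
Proof. by rewrite /qfact big_nat_recr. Qed.

Lemma qfact0 (F : fieldType) (q : F) : qfact q 0 = 1.
Proof. by rewrite /qfact big_geq. Qed.

Lemma qfact_gt0 (F : realFieldType) (q : F) m : 0 < q < 1 -> 0 < qfact q m.
Proof.
move=> q01; elim: m => [|m ih]; first by rewrite qfact0.
by rewrite qfactS mulr_gt0// qnum_gt0.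
Qed.

Lemma fmorph_qfact (F F' : fieldType) (f : {rmorphism F -> F'}) (q : F) m :
  qfact (f q) m = f (qfact q m).
Proof.
elim: m => [|m ih]; first by rewrite !qfact0 rmorph1.
by rewrite !qfactS ih rmorphM fmorph_div !rmorphB rmorphXn rmorph1.
Qed.

(** The Jackson derivative acting on coefficients, which replaces the functional equations by
    identities in [{poly F}]. *)
Definition qderiv (F : fieldType) (q : F) (p : {poly F}) : {poly F} :=
  \poly_(i < (size p).-1) (qnum q i.+1 * p`_i.+1).

Lemma coef_qderiv (F : fieldType) (q : F) (p : {poly F}) i :
  (qderiv q p)`_i = qnum q i.+1 * p`_i.+1.
Proof.
rewrite coef_poly; case: ltnP => // h; rewrite [p`__]nth_default ?mulr0//.
by case: (size p) h.
Qed.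

Lemma cvg_horner0 (K : numFieldType) (p : {poly K}) :
  (fun h : K => p.[h]) @ (0 : K)^' --> p.[0].
Proof.
elim/poly_ind: p => [|p c ih].
  by rewrite horner0; under eq_fun do rewrite horner0; exact: cvg_cst.
rewrite hornerMXaddC; under eq_fun do rewrite hornerMXaddC.
by apply: cvgD; [apply: cvgM => //; exact: cvg_within|exact: cvg_cst].
Qed.

Lemma Dq_horner (K : numFieldType) (q : K) (p : {poly K}) :
  q != 1 -> Dq q (horner p) = horner (qderiv q p).
Proof.
move=> q1; have q10 : 1 - q != 0 by rewrite subr_eq0 eq_sym.
apply/funext => z; rewrite /Dq; case: eqVneq => [->|z0].
  rewrite horner_coef0 coef_qderiv /qnum expr1 divff// mul1r.
  (* Only the decomposition into p X + c is used: away from 0 its difference quotient at 0 is p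
     itself, a continuous function. *)
  elim/poly_ind: p => [|p c _].
    rewrite coef0 /derive1; apply: norm_cvg_lim.
    under eq_fun do rewrite !horner0 subrr scaler0; exact: cvg_cst.
  rewrite coefD coefMX coefC/= addr0 -horner_coef0 /derive1; apply: norm_cvg_lim.
  apply: cvg_trans (@cvg_horner0 K p); apply: near_eq_cvg.
  near=> h; rewrite addr0 !hornerMXaddC mulr0 add0r addrK.
  rewrite [_ *: _]mulrC mulfK//; near: h; exact: nbhs_dnbhs_neq.
(* Evaluation is widened to [(size p).-1.+1] terms, so that the constant term can be split off and
   cancelled even when p = 0. *)
rewrite (horner_coef_wide _ (leqSpred _)) horner_poly.
rewrite [p.[z]](horner_coef_wide _ (leqSpred _)) -sumrB.
rewrite big_ord_recl/= !expr0 subrr add0r.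
rewrite mulr_suml; apply: eq_bigr => i _.
rewrite /bump/= add1n exprMn !exprS /qnum exprS.
field.
by rewrite z0 q10 subr_eq0 q1.
Unshelve. all: by end_near. Qed.

(** In characteristic 0 the integers below [size d] are distinct, too many roots for a nonzero
    [d]. *)
Lemma horner_inj (K : numFieldType) : injective (@horner K).
Proof.
move=> p r pr; apply/eqP; rewrite -subr_eq0; apply/negP => /negP d0.
set d := p - r in d0.
have := max_poly_roots d0 (rs := [seq i%:R | i <- iota 0 (size d)]).
rewrite size_map size_iota ltnn => h; suff: false by []; apply: h.
  by apply/allP => x _; rewrite rootE hornerD hornerN pr subrr.
by rewrite map_inj_uniq ?iota_uniq// => i j /eqP; rewrite eqr_nat => /eqP.
Qed.

Lemma poly_funE (R : realType) (p : {poly R}) :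
  poly_fun p = horner (map_poly (real_complex R) p : {poly Cx R}).
Proof. by []. Qed.

Lemma coef_qLidstone_poly (R : realType) (q : R) (c : nat -> R) n m :
  (qLidstone_poly q c n)`_m =
  if odd m || (n < m./2)%N then 0 else qbinom q n.*2 m * c (n - m./2)%N.
Proof.
rewrite coef_sum; under eq_bigr do rewrite coefZ coefXn.
case: ifPn => [|/norP[mo]].
  move=> /orP[mo|mn]; rewrite big1// => i _.
    by case: eqP mo => [->|]; rewrite ?odd_double ?mulr0.
  case: eqP mn => [->|]; rewrite ?mulr0//.
  by rewrite doubleK ltnNge -ltnS ltn_ord.
rewrite -leqNgt -ltnS => mn; have mE : m = m./2.*2 by rewrite even_halfK.
rewrite (bigD1 (Ordinal mn))//= -mE eqxx mulr1 big1 ?addr0// => i.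
rewrite -val_eqE/= => im.
by rewrite mE (inj_eq double_inj) eq_sym (negPf im) mulr0.
Qed.

Lemma even_qLidstone_IE (R : realType) (q : R) (w : nat -> {poly R}) :
  0 < q < 1 -> even_qLidstone_I q w ->
  forall n, w n = qLidstone_poly q (related_seq w) n.
Proof.
move=> q01 [wD wD0 [g0 _ w0]].
have qn1 : toC q != 1.
  by rewrite -[1]/(toC 1) (inj_eq (@complexI R)) lt_eqF//; case/andP: q01.
have Dw (p : {poly R}) : Dq (toC q) (poly_fun p) = poly_fun (qderiv q p).
  rewrite !poly_funE Dq_horner//; congr horner; apply/polyP => i.
  rewrite coef_qderiv !coef_map/= coef_qderiv rmorphM; congr (_ * _).
  by rewrite /qnum fmorph_div !rmorphB rmorphXn rmorph1.
have nf m : qnum q m.+1 != 0 by rewrite gt_eqF// qnum_gt0.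
have ff m : qfact q m != 0 by rewrite gt_eqF// qfact_gt0.
(* Comparing coefficients in the second-order recursion moves two degrees up from [w n] to
   [w n.+1]. *)
have wc n i : (w n.+1)`_i.+2 =
    qnum q n.*2.+2 * qnum q n.*2.+1 * (w n)`_i / (qnum q i.+2 * qnum q i.+1).
  have /polyP/(_ i) : qderiv q (qderiv q (w n.+1)) =
      (qnum q n.*2.+2 * qnum q n.*2.+1) *: w n.
    apply: (map_poly_inj (real_complex R)); apply: (@horner_inj (Cx R)).
    apply/funext => z; have := wD n.+1 isT z.
    rewrite !Dw /poly_fun -/(toC _) => ->.
    by rewrite map_polyZ hornerZ.
  rewrite !coef_qderiv coefZ => <-; field; by rewrite !nf.
have w1 n : (w n)`_1 = 0.
  have := wD0 n; rewrite Dw poly_funE horner_coef0 coef_map coef_qderiv/=.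
  move=> /(@complexI R _ 0)/eqP; rewrite mulf_eq0 (negPf (nf _))/= => /eqP//.
have wg n : (w n)`_0 = related_seq w n by rewrite /related_seq horner_coef0.
move=> n; apply/polyP => m; rewrite coef_qLidstone_poly.
have b0 k : qbinom q k 0 = 1 by rewrite /qbinom qfact0 subn0 mul1r divff.
(* Degrees 0 and 1 are fixed by the value and the q-derivative at 0; higher degrees vanish in [w 0]
   and otherwise follow from [wc]. *)
elim: n m => [|n ih] [|[|m]]; rewrite /= ?b0 ?mul1r ?wg ?w1 ?subn0//.
  by rewrite w0 coefC orbT.
rewrite wc ih negbK ltnS; case: ifPn => [_|]; first by rewrite mulr0 mul0r.
move=> /norP[mo]; rewrite -leqNgt subSS => mn.
have mE : m = m./2.*2 by rewrite even_halfK.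
have mn2 : (m <= n.*2)%N by rewrite mE leq_double.
rewrite /qbinom doubleS !subSS !qfactS.
by field; rewrite !nf !ff.
Qed.

(** * Generating functions *)

Lemma sum_even_ord (V : nmodType) (f : nat -> V) n :
  (forall i, odd i -> f i = 0) ->
  \sum_(i < n.*2.+1) f i = \sum_(j < n.+1) f j.*2.
Proof.
move=> f0; elim: n => [|n ih]; first by rewrite !big_ord1.
rewrite doubleS big_ord_recr big_ord_recr/= ih [RHS]big_ord_recr/= doubleS.
by rewrite f0 ?addr0//= odd_double.
Qed.

(** Only even indices contribute, and clearing the q-factorials leaves a q-binomial convolution. *)
Lemma fps_mul_qexp_even (R : realType) (q : R) (a b : nat -> {poly R}) :
  0 < q < 1 ->
  fps_mul (fps_qexp_even q a) (fps_qexp_even q b) =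
  fps_qexp_even q (fun n => \sum_(j < n.+1)
    (qfact q n.*2 / (qfact q j.*2 * qfact q (n - j).*2)) *:
    (a j * b (n - j)%N)).
Proof.
move=> q01; have ff m : qfact q m != 0 by rewrite gt_eqF// qfact_gt0.
apply/funext => m; rewrite /fps_mul [in RHS]/fps_qexp_even.
case: ifPn => mo.
  rewrite big1// => i _; rewrite /fps_qexp_even; case: ifPn => io.
    by rewrite mul0r.
  by rewrite oddB ?mo ?(negPf io) ?mulr0// -ltnS.
rewrite -[m]even_halfK//; set n := m./2.
rewrite (@sum_even_ord _ (fun i =>
  fps_qexp_even q a i * fps_qexp_even q b (n.*2 - i)%N)); last first.
  by move=> i io; rewrite /fps_qexp_even io mul0r.
rewrite doubleK scaler_sumr; apply: eq_bigr => j _.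
rewrite -doubleB /fps_qexp_even !odd_double !doubleK -scalerAl -scalerAr !scalerA.
by congr (_ *: _); field; rewrite !ff.
Qed.

(** Reversing the summation exhibits the polynomial as the q-binomial convolution of [c] with the
    powers of z, the shape produced by the product formulas. *)
Lemma qLidstone_polyE (R : realType) (q : R) (c : nat -> R) n :
  qLidstone_poly q c n = \sum_(j < n.+1)
    (qfact q n.*2 / (qfact q j.*2 * qfact q (n - j).*2)) *:
    ((c j)%:P * 'X^((n - j).*2)).
Proof.
rewrite /qLidstone_poly (reindex_inj rev_ord_inj)/=; apply: eq_bigr => j _.
have jn : (j <= n)%N by rewrite -ltnS.
rewrite subSS subKn// mul_polyC scalerA /qbinom -doubleB subKn//.
by rewrite [qfact q j.*2 * _]mulrC.
Qed.

Lemma fps_hq_coshq (R : realType) (q : R) (c : nat -> R) : 0 < q < 1 ->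
  fps_mul (fps_hq q c) (fps_coshq q) =1 fps_qexp_even q (qLidstone_poly q c).
Proof.
move=> q01 m; rewrite fps_mul_qexp_even//; congr (fps_qexp_even q _ m).
by apply/funext => n; rewrite qLidstone_polyE.
Qed.

Lemma fps_hq_conj (R : realType) (q : R) (gamma xi : nat -> R) : 0 < q < 1 ->
  conjugate_num_seq q gamma xi ->
  fps_mul (fps_hq q gamma) (fps_hq q xi) =1 @fps_one {poly R}.
Proof.
move=> q01 cj m; have ff k : qfact q k != 0 by rewrite gt_eqF// qfact_gt0.
rewrite fps_mul_qexp_even// /fps_qexp_even /fps_one.
case: ifPn => mo; first by case: m mo.
have mE : m = m./2.*2 by rewrite even_halfK.
rewrite /= -mE; have -> : (m == 0%N) = (m./2 == 0%N) by rewrite {1}mE double_eq0.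
rewrite -(rmorph_nat (@polyC R)) -cj -mul_polyC rmorph_sum mulr_sumr.
apply: eq_bigr => j _; rewrite -mul_polyC -!polyCM; congr (_%:P).
by field; rewrite !ff.
Qed.

(** * Cauchy products of the numerical series in t *)

Lemma qexp_even_term_scale (K : numFieldType) (q z t : K) (a : nat -> K) n :
  qexp_even_term q a (z * t) n = qexp_even_term q (fun n => a n * z ^+ n.*2) t n.
Proof. by rewrite /qexp_even_term exprMn mulrA. Qed.

Lemma fps_mul_qexp_even_term (K : numFieldType) (q t : K) (a b : nat -> K) :
  (forall m, qfact q m != 0) ->
  fps_mul (qexp_even_term q a t) (qexp_even_term q b t) =
  qexp_even_term q (fun n => \sum_(j < n.+1)
    qfact q n.*2 / (qfact q j.*2 * qfact q (n - j).*2) * (a j * b (n - j)%N)) t.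
Proof.
move=> ff; apply/funext => n; rewrite /qexp_even_term -mulrA mulr_suml.
apply: eq_bigr => j _.
have -> : n.*2 = (j.*2 + (n - j).*2)%N by rewrite -doubleD subnKC// -ltnS.
by rewrite exprD; field; rewrite !ff.
Qed.

Lemma qfact_toC (R : realType) (q : R) m : qfact (toC q) m = toC (qfact q m).
Proof. exact: (fmorph_qfact (real_complex R)). Qed.

Lemma qfact_toC_neq0 (R : realType) (q : R) m :
  0 < q < 1 -> qfact (toC q) m != 0.
Proof.
move=> q01; rewrite qfact_toC -[0]/(toC 0) (inj_eq (@complexI R)).
by rewrite gt_eqF// qfact_gt0.
Qed.

Lemma normc_qexp_even_term (R : realType) (q : R) (c : nat -> R) (t : Cx R) n :
  normc (qexp_even_term (toC q) (fun n => toC (c n)) t n) =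
  `|c n / qfact q n.*2| * (normc t ^+ 2) ^+ n.
Proof.
rewrite /qexp_even_term qfact_toC !normcM normcV !normc_toC normcX normrM normfV.
by rewrite -exprM mul2n mulrAC.
Qed.

Lemma fps_mul_Lidstone (R : realType) (q : R) (c : nat -> R) (z t : Cx R) :
  0 < q < 1 ->
  fps_mul (qexp_even_term (toC q) (fun n => toC (c n)) t)
    (qexp_even_term (toC q) (fun=> 1) (z * t)) =
  qexp_even_term (toC q) (fun n => poly_fun (qLidstone_poly q c n) z) t.
Proof.
move=> q01.
have -> : qexp_even_term (toC q) (fun=> 1) (z * t) =
    qexp_even_term (toC q) (fun n => z ^+ n.*2) t.
  by apply/funext => n; rewrite qexp_even_term_scale /qexp_even_term mul1r.
rewrite fps_mul_qexp_even_term; last by move=> m; exact: qfact_toC_neq0.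
apply/funext => n; rewrite /qexp_even_term; congr (_ * _ / _).
rewrite qLidstone_polyE poly_funE rmorph_sum horner_sum; apply: eq_bigr => j _ /=.
rewrite mul_polyC !map_polyZ map_polyXn !hornerE fmorph_div rmorphM.
by rewrite -!/(toC _) !qfact_toC.
Qed.

Lemma fps_mul_qexp_even_conj (R : realType) (q : R) (gamma xi : nat -> R)
    (t : Cx R) :
  conjugate_num_seq q gamma xi ->
  fps_mul (qexp_even_term (toC q) (fun n => toC (gamma n)) t)
    (qexp_even_term (toC q) (fun n => toC (xi n)) t) =1 @fps_one (Cx R).
Proof.
(* The conjugacy relation is multiplied by t^(2n), which equals 1 at the only index where the right
   side is nonzero. *)
move=> cj n; transitivity (t ^+ n.*2 * toC (n == 0%N)%:R).
  rewrite -cj /toC rmorph_sum mulr_sumr; apply: eq_bigr => j _.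
  rewrite fmorph_div !rmorphM -!/(toC _) /qexp_even_term !qfact_toC.
  have -> : n.*2 = (j.*2 + (n - j).*2)%N by rewrite -doubleD subnKC// -ltnS.
  by rewrite exprD invfM; ring.
rewrite /fps_one /toC rmorph_nat; case: n => [|n]; first by rewrite expr0 mul1r.
by rewrite mulr0.
Qed.

(** * Domains of convergence *)

Lemma normc_cvg_coshq (R : realType) (q : R) (x : Cx R) :
  0 < q < 1 -> `|x| < toC (1 - q)^-1 ->
  cvgn (series (fun n => normc (qexp_even_term (toC q) (fun=> 1) x n))).
Proof.
move=> q01; have /andP[q0 q1] := q01; have q10 : 0 < 1 - q by rewrite subr_gt0.
rewrite normCxE toC_lt; set r := normc x => rq.
have r0 : 0 <= r := normc_ge0 x.
(* As [m]_q tends to 1/(1-q), [p] is the limit of r/[m]_q; the midpoint [s] of [p] and 1 leaves room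
   for the ratio test. *)
pose p := r * (1 - q).
have p0 : 0 <= p by rewrite mulr_ge0// ltW.
have p1 : p < 1 by rewrite -ltr_pdivlMr// div1r.
pose s := (1 + p) / 2.
have s0 : 0 < s by rewrite /s; lra.
have s1 : s < 1 by rewrite /s; lra.
have ps : p < s by rewrite /s; lra.
(* This inequality is p/(1-q^n) <= s rearranged. *)
have [N _ hN] : \forall n \near \oo, q ^+ n <= 1 - p / s.
  have : (fun n => q ^+ n) @ \oo --> 0.
    by apply: cvg_expr; rewrite ger0_norm// ltW.
  move=> /cvgr0Pnorm_le/(_ (1 - p / s)); rewrite subr_gt0 ltr_pdivrMr// mul1r ps.
  move=> /(_ isT); apply: filterS => n; apply: le_trans; exact: ler_norm.
have rs n : (N <= n)%N -> r / qnum q n.+1 <= s.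
  move=> Nn; rewrite ler_pdivrMr ?qnum_gt0// /qnum mulrA ler_pdivlMr// -/p.
  rewrite mulrC -ler_pdivrMr//.
  by have := hN n.+1 (leq_trans Nn (leqnSn n)); rewrite lerBrDr -lerBrDl.
have ff m : 0 < qfact q m by rewrite qfact_gt0.
pose y n := r ^+ n.*2 / qfact q n.*2.
rewrite (_ : (fun n => _) = y); last first.
  apply/funext => n; rewrite (normc_qexp_even_term q (fun=> 1)) mul1r.
  by rewrite ger0_norm ?invr_ge0 ?ltW// mulrC -exprM mul2n.
apply: (@cvg_series_ratio _ y s N); rewrite ?s0// => n.
  by rewrite /y divr_ge0 ?exprn_ge0// ltW.
move=> Nn; have nz m : qnum q m.+1 != 0 by rewrite gt_eqF ?qnum_gt0.
have -> : y n.+1 = (r / qnum q n.*2.+1) * (r / qnum q n.*2.+2) * y n.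
  rewrite /y doubleS !qfactS !exprS; field.
  by rewrite !nz gt_eqF.
have Nn2 : (N <= n.*2)%N by rewrite (leq_trans Nn)// -addnn leq_addr.
rewrite ler_wpM2r//; first by rewrite divr_ge0 ?exprn_ge0// ltW.
have r_ge0 m : 0 <= r / qnum q m.+1.
  by apply: divr_ge0 => //; rewrite ltW// qnum_gt0.
(* One of the two factors is bounded by [s], the other merely by 1. *)
rewrite -[leRHS]mulr1; apply: ler_pM => //; first exact: rs.
by apply: le_trans (rs _ _) (ltW s1); rewrite leqW.
Qed.

Lemma near0_cvg_qexp_even (R : realType) (q : R) (c : nat -> R) (M p : R) :
  0 <= p ->
  (forall n, `|c n / qfact q n.*2| <= M * p ^+ n) ->
  \forall t \near (0 : Cx R),
    cvgn (series (qexp_even_term (toC q) (fun n => toC (c n)) t)).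
Proof.
move=> p0 cM.
(* The radius 1/(1+p) ensures both r <= 1 and p r < 1, hence p r^2 < 1, without square roots and
   also when p = 0. *)
have p10 : 0 < (1 + p)^-1 by rewrite invr_gt0 ltr_pwDl.
have /cvgr0Pnorm_lt near0 : (fun t : Cx R => t) @ (0 : Cx R) --> (0 : Cx R).
  exact: cvg_id.
have := near0 (toC (1 + p)^-1); rewrite (toC_lt 0) => /(_ p10).
apply: filterS => t.
rewrite normCxE toC_lt; set r := normc t => rp.
have r0 : 0 <= r := normc_ge0 t.
apply: normc_cvg_series.
have r1 : r <= 1.
  by rewrite (le_trans (ltW rp))// invf_le1 ?ltr_pwDl// lerDl.
have pr : p * r ^+ 2 < 1.
  apply: (@le_lt_trans _ _ (p * r)).
    by rewrite ler_wpM2l// expr2 ler_piMl.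
  have : (1 + p) * r < 1 by rewrite mulrC -ltr_pdivlMr ?div1r ?ltr_pwDl.
  by apply: le_lt_trans; rewrite mulrDl lerDr mul1r.
have M0 : 0 <= M by have := cM 0%N; rewrite expr0 mulr1; apply: le_trans.
apply: (@series_le_cvg _ _ (geometric M (p * r ^+ 2))) => [n|n|n|].
- exact: normc_ge0.
- by rewrite /= mulr_ge0// exprn_ge0// mulr_ge0// exprn_ge0.
- rewrite normc_qexp_even_term /geometric /= [(p * _) ^+ n]exprMn mulrA.
  by rewrite ler_wpM2r// exprn_ge0// exprn_ge0.
- by apply: is_cvg_geometric_series; rewrite ger0_norm// mulr_ge0// exprn_ge0.
Qed.
(* With y_n = |b_n| / p^n and c = M / |a_0|, the recursion for b gives
   y_(n+1) <= c (y_0 + ... + y_n), so these partial sums grow at most by the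
   factor 1 + c. *)
Lemma fps_inv_bound (R : realType) (a b : nat -> R) (M p : R) :
  0 < p -> fps_mul a b =1 @fps_one R -> (forall n, `|a n| <= M * p ^+ n) ->
  exists K r, 0 <= r /\ forall n, `|b n| <= K * r ^+ n.
Proof.
move=> p0 ab aM.
have M0 : 0 <= M by have := aM 0%N; rewrite expr0 mulr1; apply: le_trans.
have a00 : a 0%N != 0.
  have := ab 0%N; rewrite /fps_mul /fps_one big_ord1/=; case: eqP => // ->.
  by rewrite mul0r => /esym/eqP; rewrite oner_eq0.
have a0 : 0 < `|a 0%N| by rewrite normr_gt0.
pose c := M / `|a 0%N|.
have c0 : 0 <= c by rewrite divr_ge0.
pose y n := `|b n| / p ^+ n.
have y0 n : 0 <= y n by rewrite divr_ge0// exprn_ge0// ltW.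
(* The coefficient of index n+1 of the product vanishes, which expresses a_0 b_(n+1) through the
   earlier b_i. *)
have ys n : y n.+1 <= c * \sum_(i < n.+1) y i.
  rewrite /c mulrAC ler_pdivlMr// /y mulrAC ler_pdivrMr ?exprn_gt0//.
  have := ab n.+1; rewrite /fps_mul /fps_one big_ord_recl/= subn0 => /eqP.
  rewrite addr_eq0 => /eqP h; rewrite -normrM mulrC h normrN.
  rewrite mulr_sumr mulr_suml (le_trans (ler_norm_sum _ _ _))//.
  rewrite (reindex_inj rev_ord_inj)/=; apply: ler_sum => i _.
  have iN : (i <= n)%N by rewrite -ltnS.
  rewrite subSS /bump/= add1n subSS subKn// normrM.
  rewrite (le_trans (ler_wpM2r (normr_ge0 _) (aM _)))//.
  have -> : p ^+ n.+1 = p ^+ (n - i).+1 * p ^+ i by rewrite -exprD addSn subnK.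
  rewrite -!mulrA ler_wpM2l//.
  by rewrite [p ^- i * _]mulrCA mulVf ?mulr1 1?mulrC// expf_neq0// gt_eqF.
have S n : \sum_(i < n.+1) y i <= y 0%N * (1 + c) ^+ n.
  elim: n => [|n ih]; first by rewrite big_ord1 mulr1.
  rewrite big_ord_recr/= (le_trans (lerD (lexx _) (ys n)))//.
  rewrite -[X in X + _]mul1r -mulrDl exprS mulrCA ler_wpM2l//.
  by rewrite addr_ge0.
exists (y 0%N), ((1 + c) * p); split=> [|n].
  by rewrite mulr_ge0 ?addr_ge0// ltW.
rewrite exprMn mulrA -ler_pdivrMr ?exprn_gt0// (le_trans _ (S n))//.
by rewrite big_ord_recr/= lerDr sumr_ge0.
Qed.

(** The series of [gamma] may converge only at t = 0, so the identities are stated formally as well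
    as for convergent series. The bound on zt is the disc of convergence of cosh_q. A single nonzero
    point of convergence for [gamma] provides a neighbourhood of 0 where the second expansion has
    its convergence hypotheses on [gamma] and [xi]. *)
Theorem theorem3p18 (R : realType) (q : R) (q_gt0 : 0 < q) (q_lt1 : q < 1)
    (w w' : nat -> {poly R}) (gamma xi : nat -> R)
    (w_Lidstone : even_qLidstone_I q w)
    (gammaE : forall n : nat, gamma n = related_seq w n)
    (xi_conj : conjugate_num_seq q gamma xi)
    (w'E : forall n : nat, w' n = qLidstone_poly q xi n) :
  (* as formal power series in t *)
  [/\ fps_mul (fps_hq q gamma) (fps_coshq q) =1 fps_qexp_even q w
    & exists2 u : nat -> {poly R},
        fps_mul (fps_hq q gamma) u =1 @fps_one {poly R}
      & fps_mul u (fps_coshq q) =1 fps_qexp_even q w']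
  (* as functions of the complex variables z and t *)
  /\ [/\ forall z t : Cx R,
          cvgn (series (qexp_even_term (toC q) (fun n => toC (gamma n)) t)) ->
          `|z * t| < toC (1 - q)^-1 ->
          series (qexp_even_term (toC q) (fun n => poly_fun (w n) z) t) @ \oo
            --> hq q gamma t * coshq (toC q) (z * t),
         (exists2 t0 : Cx R, t0 != 0 &
            cvgn (series
              (qexp_even_term (toC q) (fun n => toC (gamma n)) t0))) ->
          \forall t \near (0 : Cx R),
            cvgn (series
              (qexp_even_term (toC q) (fun n => toC (gamma n)) t)) /\
            cvgn (series (qexp_even_term (toC q) (fun n => toC (xi n)) t))
       & forall z t : Cx R,
          cvgn (series (qexp_even_term (toC q) (fun n => toC (gamma n)) t)) ->
          cvgn (series (qexp_even_term (toC q) (fun n => toC (xi n)) t)) ->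
          `|z * t| < toC (1 - q)^-1 ->
          hq q gamma t != 0 /\
          series (qexp_even_term (toC q) (fun n => poly_fun (w' n) z) t) @ \oo
            --> (hq q gamma t)^-1 * coshq (toC q) (z * t)].
Proof.
have q01 : 0 < q < 1 by rewrite q_gt0.
have -> : w = qLidstone_poly q gamma.
  have -> : gamma = related_seq w by apply/funext.
  by apply/funext => n; exact: even_qLidstone_IE.
have -> : w' = qLidstone_poly q xi by apply/funext.
have cauchy c (z t : Cx R) :
    cvgn (series (qexp_even_term (toC q) (fun n => toC (c n)) t)) ->
    `|z * t| < toC (1 - q)^-1 ->
    series (qexp_even_term (toC q)
      (fun n => poly_fun (qLidstone_poly q c n) z) t)
      @ \oo --> hq q c t * coshq (toC q) (z * t).
  move=> ct zt; rewrite -(fps_mul_Lidstone _ _ _ q01).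
  exact: mertens ct (normc_cvg_coshq q01 zt).
split; split.
- exact: fps_hq_coshq.
- by exists (fps_hq q xi); [exact: fps_hq_conj|exact: fps_hq_coshq].
- exact: cauchy.
- move=> [t0 t00 ct0]; pose r := normc t0 ^+ 2.
  have t0_gt0 : 0 < normc t0.
    rewrite lt_def normc_ge0 andbT.
    by apply: contra t00 => /eqP/eq0_normc->.
  have r0 : 0 < r by rewrite exprn_gt0.
  (* The terms of the series at [t0] tend to 0, hence are bounded; dividing by |t0|^(2n) gives
     geometric growth of the coefficients. *)
  have [M gM] : exists M, forall n, `|gamma n / qfact q n.*2| <= M * r^-1 ^+ n.
    have [M tM] := cvgn_normc_bounded (cvg_series_cvg_0 ct0).
    exists M => n; rewrite exprVn ler_pdivlMr ?exprn_gt0//.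
    by rewrite -normc_qexp_even_term//; exact: tM.
  have ri0 : 0 < r^-1 by rewrite invr_gt0.
  (* Once the q-factorials are absorbed into the coefficients, conjugacy says that the two sequences
     are inverse power series in t^2, so the growth bound passes to [xi]. *)
  have gx : fps_mul (fun n => gamma n / qfact q n.*2)
      (fun n => xi n / qfact q n.*2) =1 @fps_one R.
    move=> n; rewrite /fps_one -xi_conj; apply: eq_bigr => j _.
    by rewrite invfM mulrACA.
  have [K [s [s0 xK]]] := fps_inv_bound ri0 gx gM.
  by apply: filterS2 (near0_cvg_qexp_even (ltW ri0) gM)
    (near0_cvg_qexp_even s0 xK) => t; split.
- move=> z t cg cx zt.
  have hh : hq q gamma t * hq q xi t = 1.
    apply/esym; apply: cvg_series_fps_mul cg cx _.
    (* The shift discards the empty partial sum, the only one different from 1. *)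
    rewrite (funext (fps_mul_qexp_even_conj t xi_conj)) -cvg_shiftS.
    rewrite (_ : (fun n => series (@fps_one (Cx R)) n.+1) = fun=> 1).
      exact: cvg_cst.
    by apply/funext => n; exact: series_fps_one.
  have h0 : hq q gamma t != 0.
    by apply: contra_eq_neq hh => ->; rewrite mul0r eq_sym oner_neq0.
  have -> : (hq q gamma t)^-1 = hq q xi t by apply: (mulfI h0); rewrite hh divff.
  split; first exact: h0.
  exact: cauchy cx zt.
Qed.
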